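(* Let a point electric charge of mass $m>0$ and charge $q\in\mathbb R$ move in an arbitrary magnetic field whose induction along the motion is a differentiable function of time $\vec B:I\to\mathbb R^3$, $I\subseteq\mathbb R$ an interval containing $0$, so that its velocity satisfies $$m\frac{d\vec v}{dt}=q\,\vec v\times\vec B,\qquad \vec v(0)=\vec v_0 .$$ Then the velocity hodograph is a spherical curve (on the sphere of radius $\|\vec v_0\|$ centred at the origin), obtained by rotating the initial velocity vector with angular velocity $\vec\omega_L=-\frac qm\vec B$ relative to the inertial frame; that is, $$\vec v=F_{-\frac qm\vec B}(\vec v_0).$$
   Context: Vectors are in oriented Euclidean three-space. The hodograph of $\vec v$ is the curve $t\mapsto\vec v(t)$. For a vector-valued function $\vec\omega$ of time, $\widetilde\omega(t)$ is the skew-symmetric $3\times3$ matrix with $\widetilde\omega(t)\vec x=\vec\omega(t)\times\vec x$, and the rotation tensor with angular velocity $-\vec\omega$ is $F_{-\vec\omega}(\vec x)(t)=Q(t)\vec x(t)$, where $Q$ is the unique solution of $\dot Q=-\widetilde\omega Q$, $Q(0)=I_3$; here $\vec\omega=\frac qm\vec B$. *)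

(* Defs.v *)
From HB Require Import structures.
From mathcomp Require Import all_boot all_order all_algebra.
From mathcomp Require Import all_classical all_reals all_analysis.

Set Implicit Arguments.
Unset Strict Implicit.
Unset Printing Implicit Defensive.

Import Order.TTheory GRing.Theory Num.Theory.
Import numFieldNormedType.Exports.

Local Open Scope classical_set_scope.
Local Open Scope ring_scope.

(* The norm that the library puts on matrices is the max norm; its topology is
   the usual one, but lengths of vectors need the Euclidean norm. *)
Definition enorm (R : realType) (x : 'cV[R]_3) : R :=
  Num.sqrt (\sum_i x i 0 ^+ 2).

Definition sphere (R : realType) (c : 'cV[R]_3) (r : R) : set 'cV[R]_3 :=
  [set x | enorm (x - c) = r].

(* The indices live in 'I_3, whose addition is taken modulo 3, so this is the
   cyclic formula (x \times y)_i = x_(i+1) y_(i+2) - x_(i+2) y_(i+1). *)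
Definition cross (R : realType) (x y : 'cV[R]_3) : 'cV[R]_3 :=
  \col_i (x (i + 1) 0 * y (i + 2) 0 - x (i + 2) 0 * y (i + 1) 0).

(* Column j is the cross product of w with the j-th basis vector; spinE and
   spin_skew below are the two properties that characterise this matrix. *)
Definition spin (R : realType) (w : 'cV[R]_3) : 'M[R]_3 :=
  \matrix_(i, j) cross w (delta_mx j 0) i 0.

Lemma spinE (R : realType) (w x : 'cV[R]_3) : spin w *m x = cross w x.
Proof.
apply/colP => i; rewrite !mxE.
under eq_bigr => j _ do rewrite !mxE !eqxx !andbT mulrBl -!mulrA !mulr_natl.
rewrite sumrB (bigD1 (i + 2)) //= eqxx big1 ?addr0; last first.
  by move=> j /negPf; rewrite eq_sym => ->; rewrite mulr0n mulr0.
rewrite (bigD1 (i + 1)) //= eqxx big1 ?addr0 //.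
by move=> j /negPf; rewrite eq_sym => ->; rewrite mulr0n mulr0.
Qed.

Lemma spinN (R : realType) (w : 'cV[R]_3) : spin (- w) = - spin w.
Proof. by apply/matrixP => i j; rewrite !mxE !mulNr opprB addrC opprK. Qed.

Lemma spin_skew (R : realType) (w : 'cV[R]_3) : (spin w)^T = - spin w.
Proof.
apply/matrixP => i j; rewrite !mxE !eqxx !andbT.
case: i => [[|[|[|//]]] ?]; case: j => [[|[|[|//]]] ?] /=;
  by rewrite ?(mulr0, mulr1, subr0, sub0r, opprK, oppr0);
     congr (_ _); congr (w _ _); apply/val_inj.
Qed.

(* Derivative relative to the interval I: one-sided at an end point of I, and
   independent of the values of f outside I. *)
Definition is_derive_within (R : realType) (V : normedModType R)
    (I : interval R) (f : R -> V) (t : R) (l : V) : Prop :=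
  (s - t)^-1 *: (f s - f t) @[s --> within [set` I] t^'] --> l.

Definition differentiable_on (R : realType) (V : normedModType R)
    (I : interval R) (f : R -> V) : Prop :=
  forall t, t \in I -> exists l, is_derive_within I f t l.

Definition rotation_eq (R : realType) (I : interval R) (w : R -> 'cV[R]_3)
    (Q : R -> 'M[R]_3) : Prop :=
  Q 0 = 1%:M /\
  forall t, t \in I -> is_derive_within I Q t (spin (w t) *m Q t).

(* The solution of the rotation equation is unique on I only, where it is used;
   xget picks one of the functions on R solving the equation on I. *)
Definition rotation_matrix (R : realType) (I : interval R)
    (w : R -> 'cV[R]_3) : R -> 'M[R]_3 :=
  xget (fun=> 1%:M) [set Q | rotation_eq I w Q].

(* F_w, where w is the angular velocity itself: for w = - omega the equation is
   Q' = - spin omega *m Q, by spinN. *)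
Definition rotation_tensor (R : realType) (I : interval R)
    (w x : R -> 'cV[R]_3) : R -> 'cV[R]_3 :=
  fun t => rotation_matrix I w t *m x t.

(* Main.v *)
Require Import Defs.
From HB Require Import structures.
From mathcomp Require Import all_boot all_order all_algebra.
From mathcomp Require Import all_classical all_reals all_analysis.
From mathcomp Require Import ring lra.

Set Implicit Arguments.
Unset Strict Implicit.
Unset Printing Implicit Defensive.

Import Order.TTheory GRing.Theory Num.Theory.
Import numFieldNormedType.Exports.

Local Open Scope classical_set_scope.
Local Open Scope ring_scope.

(** Put w = - (q / m) B.  Newton's law reads v' = w x v = spin w v, a linear
    equation whose matrix is skew-symmetric.

    If u' = S u with S skew-symmetric, then the derivative of the squared
    Euclidean norm of u is 2 u . S u = 0, so that the norm is constant
    ([skew_sqnorm_constant]).  Applied to v, this puts the hodograph on the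
    sphere.  Applied to the difference of two solutions, it shows that a solution
    is determined by its value at 0 ([skew_equation_unique]).  If Q is the
    rotation matrix with angular velocity w, then Q v0 satisfies the same equation
    as v and has the same initial value, whence v = Q v0.

    What remains is that Q exists: the rotation matrix is chosen among the
    solutions of Q' = spin w Q, Q 0 = 1, and the choice is meaningless if there
    are none.  For a matrix A that is bounded and continuous on the whole line,
    Picard iteration solves Q' = A Q ([linear_equation_solution]); in the norm
    weighted by expR (- L |t|), with L large enough, one iteration halves
    distances, so that the iterates converge on the whole line at once.  On a
    segment, spin w is extended by its values at the end points, which is a
    bounded continuous extension ([rotation_eq_segment]).  On an arbitrary interval the
    solutions on the segments between 0 and t agree where they overlap, by
    uniqueness, and so they glue together ([rotation_eq_solution]). *)

(** * Antiderivatives and exponential growth *)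

Section antiderivative.
Variable R : realType.
Implicit Types f F : R -> R.

Lemma is_derive_continuous f (df : R -> R) :
  (forall t, is_derive t (1 : R) f (df t)) -> continuous f.
Proof.
move=> fdf t; apply/differentiable_continuous/derivable1_diffP.
by have [] := fdf t.
Qed.

(** The integral of [f] from 0 to [t], for either sign of [t]: both integrals
    start at a point to the left of 0 and of [t], where the choice of that point
    does not matter by [primitiveE]. *)
Definition primitive f t : R :=
  \int[lebesgue_measure]_(s in `[- (`|t| + 1), t]) f s -
  \int[lebesgue_measure]_(s in `[- (`|t| + 1), 0]) f s.

Lemma primitive0 f : primitive f 0 = 0.
Proof. exact: subrr. Qed.

(** The lower end point is the same for all [t] in an open interval, as the
    fundamental theorem of calculus requires. *)
Lemma primitiveE f c t : continuous f -> - c < t < c ->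
  primitive f t = \int[lebesgue_measure]_(s in `[- c, t]) f s -
                  \int[lebesgue_measure]_(s in `[- c, 0]) f s.
Proof.
move=> cf tc.
have intf a b : lebesgue_measure.-integrable `[a, b] (EFin \o f).
  apply: continuous_compact_integrable; first exact: segment_compact.
  exact: continuous_subspaceT.
have c0 : 0 < c by lra.
wlog suff : / forall a b, a <= b -> b < 0 -> b < t ->
  \int[lebesgue_measure]_(s in `[a, t]) f s -
  \int[lebesgue_measure]_(s in `[a, 0]) f s =
  \int[lebesgue_measure]_(s in `[b, t]) f s -
  \int[lebesgue_measure]_(s in `[b, 0]) f s.
  move=> H; rewrite /primitive.
  have t0 : 0 <= `|t| by [].
  have t1 : - t <= `|t| by rewrite -normrN ler_norm.
  have [le|le] := leP (- (`|t| + 1)) (- c).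
    by apply: H => //; lra.
  by apply/esym/H; lra.
move=> a b ab b0 bt.
have split u : b < u -> \int[lebesgue_measure]_(s in `[a, u]) f s =
    \int[lebesgue_measure]_(s in `[a, b]) f s +
    \int[lebesgue_measure]_(s in `[b, u]) f s.
  move=> bu; rewrite -(@Rintegral_itv_obnd_cbnd _ b); last first.
    by apply: integrableS (intf b u) => //; exact: subset_itv_oc_cc.
  by rewrite -(Rintegral_itvB (intf a u)) ?bnd_simp ?(ltW bu)// addrC subrK.
by rewrite (split t bt) (split 0 b0) opprD addrACA subrr add0r.
Qed.

Lemma is_derive_primitive f t :
  continuous f -> is_derive t (1 : R) (primitive f) (f t).
Proof.
move=> cf; pose c := `|t| + 1.
have tc : - c < t < c by rewrite -ltr_norml ltrDl.
apply: (@near_eq_is_derive _ _ _ (fun s =>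
  \int[lebesgue_measure]_(r in `[- c, s]) f r -
  \int[lebesgue_measure]_(r in `[- c, 0]) f r)).
  near=> s; apply/esym/primitiveE => //; near: s.
  have : t \in `]-c, c[ by rewrite in_itv.
  move=> /near_in_itvoo; apply: filterS => s; by rewrite in_itv.
have /andP[ct tc'] := tc.
have intf : lebesgue_measure.-integrable `[- c, c] (EFin \o f).
  apply: continuous_compact_integrable; first exact: segment_compact.
  exact: continuous_subspaceT.
have [dF F'] := continuous_FTC1_closed tc' intf ct (cf t).
rewrite derive1E in F'.
rewrite -[f t]subr0; apply: is_deriveB; by apply: DeriveDef.
Unshelve. all: by end_near. Qed.

(** For [t >= 0], the function [c * expR (L * t) - F t] is nondecreasing; the
    other cases follow by replacing [F] with its opposite and [t] with [- t]. *)
Lemma le_expR_of_derive F f (L c : R) : F 0 = 0 ->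
  (forall t, is_derive t (1 : R) F (f t)) ->
  (forall t, `|f t| <= c * L * expR (L * `|t|)) -> 0 <= c ->
  forall t, `|F t| <= c * expR (L * `|t|).
Proof.
move=> F0 dF fb c0.
suff H (g dg : R -> R) : g 0 = 0 -> (forall t, is_derive t (1 : R) g (dg t)) ->
    (forall t, `|dg t| <= c * L * expR (L * `|t|)) ->
    forall t, 0 <= t -> g t <= c * expR (L * t).
  have dFN t : is_derive t (1 : R) (fun s => F (- s)) (- f (- t)).
    rewrite -mulrN1; apply: (@is_derive1_comp _ F -%R t (f (- t)) (- 1)).
  move=> t; have [t0|t0] := ger0P t; rewrite ler_norml lerNl; apply/andP; split.
  - apply: (H (fun s => - F s) (fun s => - f s)) => //.
    + by rewrite F0 oppr0.
    + by move=> s; rewrite normrN.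
  - exact: (H F f).
  - rewrite -[in F t](opprK t).
    apply: (H (fun s => - F (- s)) (fun s => - - f (- s))).
    + by rewrite oppr0 F0 oppr0.
    + by move=> s; rewrite !normrN -(normrN s).
    + by rewrite oppr_ge0 ltW.
  - rewrite -[in F t](opprK t).
    apply: (H (fun s => F (- s)) (fun s => - f (- s))) => //.
    + by rewrite oppr0.
    + by move=> s; rewrite normrN -(normrN s).
    + by rewrite oppr_ge0 ltW.
move=> g0 dgE dgb t t0.
pose h s := c * expR (L * s) - g s.
have dh s : is_derive s (1 : R) h (c * L * expR (L * s) - dg s).
  apply: is_deriveB.
  apply: is_derive_eq.
  by rewrite /GRing.scale/=; ring.
have [|x] := @MVT_segment _ h _ 0 t t0 (fun s _ => dh s).
  apply: continuous_subspaceT; exact: is_derive_continuous dh.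
rewrite in_itv/= => /andP[x0 _] hE.
have : 0 <= (c * L * expR (L * x) - dg x) * (t - 0).
  apply: mulr_ge0; last by rewrite subr0.
  rewrite subr_ge0 (le_trans (ler_norm _))// (le_trans (dgb _))//.
  by rewrite ger0_norm.
rewrite -hE /h g0 mulr0 expR0; lra.
Qed.

End antiderivative.

(** * Linear differential equations on the line *)

Section linear_equation.
Variable R : realType.

Lemma eq0_of_le_geometric (x C : R) : (forall k, `|x| <= C / 2 ^+ k) -> x = 0.
Proof.
move=> xC; apply/eqP/negPn/negP => x0.
have C0 : 0 <= C by have := xC 0%N; rewrite expr0 divr1; apply: le_trans.
have y0 : 0 <= C / `|x| by rewrite divr_ge0.
have := xC (Num.bound (C / `|x|)); apply/negP; rewrite -ltNge.
rewrite ltr_pdivrMr ?exprn_gt0// -ltr_pdivrMl ?normr_gt0// mulrC.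
by rewrite (lt_le_trans (archi_boundP y0))// -natrX ler_nat ltnW// ltn_expl.
Qed.

(** The intervals of centre [u k] and radius [C *+ 2 / 2 ^+ k] are nested, so
    that the supremum of their left ends lies in all of them. *)
Lemma geometric_limit (u : R ^nat) (C : R) : 0 <= C ->
  (forall k, `|u k.+1 - u k| <= C / 2 ^+ k) ->
  exists l, forall k, `|l - u k| <= C *+ 2 / 2 ^+ k.
Proof.
move=> C0 uC.
pose r k : R := C *+ 2 / 2 ^+ k.
have rS k : r k = r k.+1 + C / 2 ^+ k.
  rewrite /r exprS; field; rewrite expf_neq0//.
have r0 k : 0 <= r k by rewrite divr_ge0 ?mulrn_wge0// exprn_ge0.
have lo : {homo (fun k => u k - r k) : i j / (i <= j)%N >-> i <= j}.
  apply: homo_leq => [//|x y z|k]; first exact: le_trans.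
  by have := uC k; rewrite ler_norml (rS k); lra.
have hi : {homo (fun k => u k + r k) : i j / (i <= j)%N >-> j <= i}.
  apply: homo_leq => [//|x y z yx zy|k]; first exact: le_trans zy yx.
  by have := uC k; rewrite ler_norml (rS k); lra.
have lohi i j : u i - r i <= u j + r j.
  have ri := r0 (maxn i j).
  have := lo _ _ (leq_maxl i j); have := hi _ _ (leq_maxr i j); lra.
pose A := range (fun k => u k - r k).
have ubA j : ubound A (u j + r j) by move=> _ [i _ <-].
have supA : has_sup A by split;
  [exists (u 0%N - r 0%N), 0%N|exists (u 0%N + r 0%N)].
exists (sup A) => k; rewrite -/(r k) ler_distl.
have := sup_upper_bound supA (imageP (fun k => u k - r k) I : A (u k - r k)).
have := ge_sup supA.1 (ubA k); lra.
Qed.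

Definition entries_continuous m n (Y : R -> 'M[R]_(m, n)) :=
  forall i j, continuous (fun t => Y t i j).

Lemma entries_continuous_mulmx m n p (A : R -> 'M[R]_(m, n))
    (Y : R -> 'M[R]_(n, p)) :
  entries_continuous A -> entries_continuous Y ->
  entries_continuous (fun t => A t *m Y t).
Proof.
move=> cA cY i j t.
rewrite (_ : (fun s => _) = fun s => \sum_k A s i k * Y s k j); last first.
  by apply/funext => s; rewrite mxE.
apply: cvg_big => [|k _]; first exact: add_continuous.
by apply: cvgM; [exact: cA|exact: cY].
Qed.

Lemma mulmx_entry_le m n p (A : 'M[R]_(m, n)) (Y : 'M[R]_(n, p)) (a y : R) :
  (forall i j, `|A i j| <= a) -> (forall i j, `|Y i j| <= y) ->
  forall i j, `|(A *m Y) i j| <= n%:R * a * y.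
Proof.
move=> Aa Yy i j; rewrite mxE (le_trans (ler_norm_sum _ _ _))//.
rewrite -mulrA mulr_natl -[n in _ *+ n]card_ord -sumr_const ler_sum// => k _.
by rewrite normrM ler_pM.
Qed.

Variables (n p : nat) (A : R -> 'M[R]_n) (M : R) (C : 'M[R]_(n, p)).
Hypothesis A_continuous : entries_continuous A.
Hypothesis A_le : forall t i j, `|A t i j| <= M.
Hypothesis M_ge0 : 0 <= M.
Implicit Types Y Z : R -> 'M[R]_(n, p).

(* Multiplication by [A t] increases the largest entry by a factor of at most
   [n%:R * M]; the growth rate is twice that for [picard] to halve distances. *)
Let L : R := n%:R * M *+ 2.
Let E (t : R) : R := expR (L * `|t|).

Definition picard Y : R -> 'M[R]_(n, p) := fun t =>
  \matrix_(i, j) (C i j + primitive (fun s => (A s *m Y s) i j) t).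

Lemma picard0 Y : picard Y 0 = C.
Proof. by apply/matrixP => i j; rewrite mxE primitive0 addr0. Qed.

Lemma is_derive_picard Y t i j : entries_continuous Y ->
  is_derive t (1 : R) (fun s => picard Y s i j) ((A t *m Y t) i j).
Proof.
move=> cY.
rewrite (_ : (fun s => _) =
    cst (C i j) + primitive (fun s => (A s *m Y s) i j)); last first.
  by apply/funext => s; rewrite mxE.
rewrite -[X in is_derive _ _ _ X]add0r; apply: is_deriveD.
apply: (is_derive_primitive (f := fun s => (A s *m Y s) i j)).
exact: entries_continuous_mulmx.
Qed.

Lemma picard_continuous Y : entries_continuous Y -> entries_continuous (picard Y).
Proof.
move=> cY i j; apply: is_derive_continuous => t; exact: is_derive_picard.
Qed.

(** The derivative of the difference is at most [n%:R * M * c * E t], which is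
    [c / 2 * L * E t] by the choice of [L]. *)
Lemma picard_contraction Y Z c : entries_continuous Y -> entries_continuous Z ->
  0 <= c -> (forall t i j, `|Y t i j - Z t i j| <= c * E t) ->
  forall t i j, `|picard Y t i j - picard Z t i j| <= c / 2 * E t.
Proof.
move=> cY cZ c0 YZ t i j.
apply: (@le_expR_of_derive _ (fun s => picard Y s i j - picard Z s i j)
  (fun s => (A s *m Y s) i j - (A s *m Z s) i j)).
- by rewrite !picard0 subrr.
- move=> s.
  apply: (@is_deriveB _ _ _ (fun s => picard Y s i j) (fun s => picard Z s i j)).
    exact: is_derive_picard.
  exact: is_derive_picard.
- move=> s; have := mulmx_entry_le (Y := Y s - Z s) (A_le s) (y := c * E s).
  rewrite mulmxBr => /(_ _ i j); rewrite !mxE => H.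
  apply: le_trans (H _) _; first by move=> k l; rewrite !mxE.
  by rewrite le_eqVlt; apply/orP; left; apply/eqP; rewrite /E /L; field.
- by rewrite divr_ge0.
Qed.

(** The iterates converge to some [Q], uniformly on bounded sets, so that [Q] is
    continuous and has a Picard iterate; by contraction, that iterate is [Q]
    itself, and iterates are differentiable. *)
Lemma linear_equation_solution : exists Q : R -> 'M[R]_(n, p), Q 0 = C /\
  forall t i j, is_derive t (1 : R) (fun s => Q s i j) ((A t *m Q t) i j).
Proof.
pose K : R := mx_norm C.
have CK i j : `|C i j| <= K.
  by rewrite /K mx_normrE (le_trans _ (le_bigmax _ _ (i, j))).
have E_ge1 t : 1 <= E t.
  by rewrite -expR0 ler_expR mulr_ge0// mulrn_wge0// mulr_ge0.
have E0 t : 0 <= E t by exact: expR_ge0.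
have K0 : 0 <= K by rewrite /K /mx_norm.
have K2 k : 0 <= K / 2 ^+ k by rewrite divr_ge0 ?exprn_ge0.
pose Y k := iter k picard (fun=> C).
have cY k : entries_continuous (Y k).
  elim: k => [i j|k IH]; first exact: cst_continuous.
  exact: picard_continuous.
have YS k t i j : `|Y k.+1 t i j - Y k t i j| <= K / 2 ^+ k * E t.
  elim: k t i j => [|k IH] t i j; last first.
    rewrite exprSr invfM mulrA.
    exact: (@picard_contraction (Y k.+1) (Y k)).
  rewrite expr0 divr1; apply: le_trans (_ : K / 2 * E t <= _); last first.
    by rewrite ler_wpM2r// ler_pdivrMr// ler_peMr// (ler1n _ 2).
  apply: (@le_expR_of_derive _ (fun s => picard (fun=> C) s i j - C i j)
    (fun s => (A s *m C) i j)) => [|s|s|].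
  - by rewrite picard0 subrr.
  - rewrite -[X in is_derive _ _ _ X]subr0.
    apply: (@is_deriveB _ _ _ (fun s => picard (fun=> C) s i j) (cst (C i j))).
    exact: (@is_derive_picard (Y 0%N)).
  - apply: le_trans (mulmx_entry_le (A_le s) CK i j) _.
    rewrite (_ : K / 2 * L = n%:R * M * K); last by rewrite /L; field.
    by rewrite ler_peMr ?E_ge1// !mulr_ge0.
  - by rewrite divr_ge0.
have [Q QY] : exists Q : R -> 'M[R]_(n, p), forall t k i j,
    `|Q t i j - Y k t i j| <= K / 2 ^+ k * E t *+ 2.
  have lim t i j : exists l, forall k, `|l - Y k t i j| <= K / 2 ^+ k * E t *+ 2.
    have [||l lE] := @geometric_limit (fun k => Y k t i j) (K * E t).
    - exact: mulr_ge0.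
    - by move=> k; rewrite mulrAC.
    - by exists l => k; rewrite mulrAC -mulrnAl.
  exists (fun t => \matrix_(i, j) projT1 (cid (lim t i j))) => t k i j.
  by rewrite mxE; case: cid => /= l; apply.
(* Near t, the weight E is at most E t + 1. *)
have cQ : entries_continuous Q.
  move=> i j t; apply/cvgrPdist_le => e e0.
  have [k Kk] : exists k, K / 2 ^+ k * (E t + 1) *+ 2 <= e / 3.
    apply: contrapT => /forallNP H.
    have : e / 3 = 0.
      apply: (@eq0_of_le_geometric _ (K * (E t + 1) *+ 2)) => k.
      rewrite ger0_norm ?divr_ge0 ?(ltW e0)//.
      by have /negP := H k; rewrite -ltNge mulrAC mulrnAl => /ltW.
    by move/eqP; rewrite gt_eqF// divr_gt0.
  have cE : E s @[s --> t] --> E t.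
    apply: (@continuous_comp _ _ _ (fun s : R => L * `|s|) expR); last first.
      exact: continuous_expR.
    by apply: cvgM; [exact: cvg_cst|exact: norm_continuous].
  have QYk s : E s <= E t + 1 -> `|Q s i j - Y k s i j| <= e / 3.
    move=> Es; apply: le_trans (QY s k i j) _; apply: le_trans _ Kk.
    by rewrite lerMn2r/= ler_wpM2l.
  have e3 : 0 < e / 3 by rewrite divr_gt0.
  near=> s.
  have Es : E s <= E t + 1.
    near: s; apply: cvgr_le cE _ _; by rewrite ltrDl.
  have Yk : `|Y k t i j - Y k s i j| <= e / 3.
    near: s; by have /cvgrPdist_le := cY k i j t; apply.
  have := QYk t; rewrite lerDl ler01 => /(_ isT).
  have := QYk s Es; move: Yk; rewrite !ler_norml; lra.
have QE : Q = picard Q.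
  apply/funext => t; apply/matrixP => i j; apply/eqP; rewrite -subr_eq0.
  apply/eqP/(@eq0_of_le_geometric _ (K * E t *+ 2)) => k.
  have Qk := QY t k.+1 i j.
  have Pk : `|picard Q t i j - Y k.+1 t i j| <= K / 2 ^+ k *+ 2 / 2 * E t.
    apply: (picard_contraction cQ (cY k)); first by rewrite mulrn_wge0.
    by move=> s k' l; rewrite mulrnAl.
  have -> : K * E t *+ 2 / 2 ^+ k =
      K / 2 ^+ k.+1 * E t *+ 2 + K / 2 ^+ k *+ 2 / 2 * E t.
    by rewrite exprS; field; rewrite expf_neq0.
  move: Qk Pk; rewrite !ler_norml; lra.
exists Q; split; first by rewrite QE picard0.
move=> t i j; rewrite {1}QE; exact: is_derive_picard.
Unshelve. all: by end_near. Qed.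

End linear_equation.

(** * Derivatives relative to an interval *)

Section derivative_within.
Variable R : realType.
Implicit Types (I J : interval R) (t : R).

(** Without division by [s - t], the point [s = t] need not be excluded and
    estimates carry over directly between a matrix and its entries. *)
Lemma is_derive_withinP (V : normedModType R) I (f : R -> V) t l :
  is_derive_within I f t l <->
  forall e, 0 < e -> \forall s \near t, s \in I ->
    `|f s - f t - (s - t) *: l| <= e * `|s - t|.
Proof.
have key s e : s != t -> (`|l - (s - t)^-1 *: (f s - f t)| <= e) =
    (`|f s - f t - (s - t) *: l| <= e * `|s - t|).
  move=> st; have st0 : s - t != 0 by rewrite subr_eq0.
  rewrite -[in RHS](scalerKV st0 (f s - f t)) -scalerBr normrZ mulrC.
  by rewrite ler_pM2r ?normr_gt0// distrC.
split=> [/cvgrPdist_le H e e0|H].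
  move: (H e e0); rewrite !near_withinE; apply: filterS => s sl sI.
  have [->|st] := eqVneq s t.
    by rewrite !subrr scale0r subr0 !normr0 mulr0.
  by rewrite -key//; exact: sl.
apply/cvgrPdist_le => e e0; rewrite !near_withinE.
apply: filterS (H e e0) => s sl st sI; rewrite key//; exact: sl.
Qed.

Lemma mx_norm_le m n (M : 'M[R]_(m, n)) e : 0 <= e ->
  `|M| <= e <-> forall i j, `|M i j| <= e.
Proof.
move=> e0; rewrite /Num.norm/= mx_normrE; split=> [Me i j|Me].
  exact: le_trans (le_bigmax _ _ (i, j)) Me.
by apply: bigmax_le => // -[i j] _; exact: Me.
Qed.

Lemma is_derive_within_mxP m n I (F : R -> 'M[R]_(m, n)) t D :
  is_derive_within I F t D <->
  forall i j, is_derive_within I (fun s => F s i j) t (D i j).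
Proof.
split=> [/is_derive_withinP FD i j|FD].
  apply/is_derive_withinP => e e0; apply: filterS (FD e e0) => s sD sI.
  have /mx_norm_le/(_ i j) := sD sI.
  by rewrite !mxE; apply; rewrite mulr_ge0// ltW.
apply/is_derive_withinP => e e0.
have : \forall s \near t, forall ij : 'I_m * 'I_n, s \in I ->
    `|F s ij.1 ij.2 - F t ij.1 ij.2 - (s - t) *: D ij.1 ij.2| <= e * `|s - t|.
  apply: (@filter_forall R _ (fun ij s => s \in I ->
    `|F s ij.1 ij.2 - F t ij.1 ij.2 - (s - t) *: D ij.1 ij.2| <= e * `|s - t|)
    (nbhs t) (nbhs_filter t)).
  by move=> -[i j]; have /is_derive_withinP := FD i j; apply.
apply: filterS => s sD sI; apply/mx_norm_le; first by rewrite mulr_ge0// ltW.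
by move=> i j; have := sD (i, j) sI; rewrite !mxE.
Qed.

(** The derivative relative to an interval is local: near [t], the points of
    [I] only have to be in [J]. *)
Lemma is_derive_within_sub (V : normedModType R) I J (f g : R -> V) t l :
  (\forall s \near t, s \in I -> s \in J) -> t \in J ->
  {in J, f =1 g} -> is_derive_within J g t l -> is_derive_within I f t l.
Proof.
move=> IJ tJ fg /is_derive_withinP gl; apply/is_derive_withinP => e e0.
apply: filterS2 IJ (gl e e0) => s sJ sl sI.
by rewrite !fg//; [apply/sl/sJ|exact: sJ].
Qed.

Lemma is_derive_withinB (V : normedModType R) I (f g : R -> V) t l k :
  is_derive_within I f t l -> is_derive_within I g t k ->
  is_derive_within I (fun s => f s - g s) t (l - k).
Proof.
move=> fl gk; rewrite /is_derive_within.
rewrite (_ : (fun s => _) = fun s => (s - t)^-1 *: (f s - f t) -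
                                     (s - t)^-1 *: (g s - g t)).
  exact: cvgB.
by apply/funext => s; rewrite -scalerBr !opprD !opprK addrACA.
Qed.

Lemma is_derive_within_mulmx m n p I (F : R -> 'M[R]_(m, n)) t D
    (X : 'M[R]_(n, p)) : is_derive_within I F t D ->
  is_derive_within I (fun s => F s *m X) t (D *m X).
Proof.
move=> /is_derive_withinP FD; apply/is_derive_withinP => e e0.
pose c := n%:R * `|X| + 1.
have c0 : 0 < c by rewrite ltr_wpDl// mulr_ge0.
have ec0 : 0 < e / c by rewrite divr_gt0.
apply: filterS (FD _ ec0) => s sD sI.
have e1 : 0 <= e * `|s - t| by rewrite mulr_ge0// ltW.
have e2 : 0 <= e / c * `|s - t| by rewrite mulr_ge0// ltW.
apply/mx_norm_le => // i j; rewrite -!mulmxBl scalemxAl -mulmxBl.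
have /(mx_norm_le _ e2) sD' := sD sI.
have XX k l : `|X k l| <= `|X| by exact: (mx_norm_le _ _).1.
apply: le_trans (mulmx_entry_le sD' XX i j) _.
rewrite (_ : n%:R * _ * _ = e * `|s - t| * (n%:R * `|X| / c)); last first.
  by field; rewrite gt_eqF.
by rewrite ler_piMr// ler_pdivrMr// mul1r lerDl ler01.
Qed.

Lemma is_derive_within_continuous I (f : R -> R) t l :
  is_derive_within I f t l -> f s @[s --> within [set` I] (nbhs t)] --> f t.
Proof.
move=> /is_derive_withinP fl; apply/cvgrPdist_le => e e0.
have c0 : 0 < 1 + `|l| by rewrite ltr_pwDl.
have ec0 : 0 < e / (1 + `|l|) by rewrite divr_gt0.
rewrite near_withinE; near=> s => sI.
have st : `|t - s| <= e / (1 + `|l|).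
  by near: s; apply: cvgr_dist_le => //; exact: cvg_id.
have fs : `|f s - f t - (s - t) *: l| <= 1 * `|s - t|.
  by move: sI; near: s; exact: fl.
rewrite distrC -(subrK ((s - t) *: l) (f s - f t)).
rewrite (le_trans (ler_normD _ _))//.
rewrite normrZ (distrC s) in fs *.
rewrite ler_pdivlMr// in st.
lra.
Unshelve. all: by end_near. Qed.

Lemma is_derive_is_derive_within I (f : R -> R) t l :
  is_derive t (1 : R) f l -> is_derive_within I f t l.
Proof.
move=> /is_derive1_caratheodory[g [fg cg <-]]; apply/is_derive_withinP => e e0.
move/cvgrPdist_le : cg => /(_ e e0); apply: filterS => s gs _.
by rewrite fg /GRing.scale/= mulrC -mulrBr normrM mulrC ler_wpM2r// distrC.
Qed.

Lemma is_derive_within_interior I (f : R -> R) t l :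
  (\forall s \near t, s \in I) -> is_derive_within I f t l ->
  is_derive t (1 : R) f l.
Proof.
move=> It /is_derive_withinP fl; apply/is_derive1_caratheodory.
exists (fun s => if s == t then l else (f s - f t) / (s - t)); split => [s||].
- by case: eqP => [->|/eqP st]; rewrite ?subrr ?mulr0// divfK// subr_eq0.
- apply/cvgrPdist_le => e e0; apply: filterS2 It (fl e e0) => s sI /(_ sI).
  rewrite eqxx; have [_ _|st sl] := eqVneq s t.
    by rewrite subrr normr0 ltW.
  have st0 : s - t != 0 by rewrite subr_eq0.
  rewrite -(ler_pM2r (x := `|s - t|)) ?normr_gt0// -normrM.
  by rewrite mulrBl divfK// (mulrC l) distrC.
- by rewrite eqxx.
Qed.

End derivative_within.

(** * Linear equations with a skew-symmetric matrix *)

Section skew_equation.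
Variables (R : realType) (n : nat).
Implicit Types (I : interval R) (S : R -> 'M[R]_n) (u : R -> 'cV[R]_n).

(** The number [u . S u] is its own transpose, hence its own opposite. *)
Lemma skew_dot_eq0 (S : 'M[R]_n) (u : 'cV[R]_n) : S^T = - S ->
  \sum_i u i 0 * (S *m u) i 0 = 0.
Proof.
move=> ST; pose d := u^T *m (S *m u).
have dT : d^T = - d.
  by rewrite /d !trmx_mul trmxK ST mulmxN mulNmx mulmxA.
have : d 0 0 = - d 0 0 by rewrite -[in LHS](trmxK d) mxE dT mxE.
have -> : d 0 0 = \sum_i u i 0 * (S *m u) i 0.
  by rewrite mxE; apply: eq_bigr => i _; rewrite mxE.
lra.
Qed.

(** Mean value theorem, since the derivative of the squared norm is
    [2 u . S u = 0]. *)
Lemma skew_sqnorm_constant I S u :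
  (forall t, t \in I -> (S t)^T = - S t) ->
  (forall t, t \in I -> is_derive_within I u t (S t *m u t)) ->
  forall a b, a \in I -> b \in I ->
  \sum_i u a i 0 ^+ 2 = \sum_i u b i 0 ^+ 2.
Proof.
move=> ST du a b; wlog ab : a b / a <= b.
  by move=> H aI bI; have [/H|/ltW/H ->] := leP a b; first exact.
move=> aI bI.
have abI s : s \in `[a, b] -> s \in I.
  by rewrite in_itv/=; exact: (@interval_is_interval _ I a b).
have du_entry i s : s \in I ->
    is_derive_within I (fun r => u r i 0) s ((S s *m u s) i 0).
  by move=> sI; have /is_derive_within_mxP := du s sI; apply.
have cu i : {within `[a, b], continuous (fun s => u s i 0)}.
  apply/subspace_continuousP => s sab.
  apply: cvg_trans _ (is_derive_within_continuous (du_entry i s (abI s sab))).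
  by apply: cvg_fmap2; apply: within_subset => r; exact: abI.
have [||c _] := @MVT_segment _ (fun s => \sum_i u s i 0 ^+ 2) (fun=> 0) a b ab.
- move=> s sab; have sI : s \in I by apply/abI/subset_itv_oo_cc.
  have nI : \forall r \near s, r \in I.
    by apply: filterS (near_in_itvoo sab) => r /subset_itv_oo_cc/abI.
  rewrite (_ : (fun s => _) = \sum_i (fun s => u s i 0) ^+ 2); last first.
    by apply/funext => r; rewrite fct_sumE.
  have du2 i : is_derive s (1 : R) ((fun r => u r i 0) ^+ 2)
      ((2 * u s i 0) *: (S s *m u s) i 0).
    have := is_derive_within_interior nI (du_entry i s sI) => dui.
    apply: is_derive_eq.
    by rewrite expr1 mulr_natl.
  have <- : \sum_i (2 * u s i 0) *: (S s *m u s) i 0 = 0.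
    under eq_bigr => i _ do rewrite /GRing.scale/= -mulrA.
    by rewrite -mulr_sumr (skew_dot_eq0 (u s) (ST s sI)) mulr0.
  exact: (is_derive_sum du2).
- move=> s; apply: cvg_big => [|i _]; first exact: add_continuous.
  by rewrite /GRing.exp/=; apply: cvgM; exact: cu.
- by rewrite mul0r => /eqP; rewrite subr_eq0 => /eqP.
Qed.

(** The difference of the solutions has constant norm, and it vanishes at 0. *)
Lemma skew_equation_unique I S u1 u2 : 0 \in I ->
  (forall t, t \in I -> (S t)^T = - S t) ->
  (forall t, t \in I -> is_derive_within I u1 t (S t *m u1 t)) ->
  (forall t, t \in I -> is_derive_within I u2 t (S t *m u2 t)) ->
  u1 0 = u2 0 -> forall t, t \in I -> u1 t = u2 t.
Proof.
move=> I0 ST du1 du2 u12 t tI.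
have du s : s \in I ->
    is_derive_within I (fun r => u1 r - u2 r) s (S s *m (u1 s - u2 s)).
  move=> sI; rewrite mulmxBr.
  by apply: is_derive_withinB; [exact: du1|exact: du2].
have := skew_sqnorm_constant ST du tI I0.
rewrite u12 [RHS]big1 => [|i _]; last by rewrite subrr mxE expr0n.
move=> /eqP; rewrite psumr_eq0 => [/allP d0|i _]; last exact: sqr_ge0.
apply/colP => i; have := d0 i; rewrite mem_index_enum => /(_ isT).
by rewrite /= sqrf_eq0 !mxE subr_eq0 => /eqP.
Qed.

End skew_equation.

(** * Existence of the rotation *)

Section rotation.
Variable R : realType.
Implicit Types (I J : interval R) (w : R -> 'cV[R]_3) (Q : R -> 'M[R]_3).

Definition clamp (a b t : R) : R := Num.max a (Num.min b t).

Lemma clamp_itv a b t : a <= b -> clamp a b t \in `[a, b].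
Proof.
by move=> ab; rewrite in_itv/= /clamp le_max lexx/= ge_max ab ge_min lexx.
Qed.

Lemma clamp_id a b t : t \in `[a, b] -> clamp a b t = t.
Proof.
rewrite in_itv/= /clamp => /andP[at_ tb].
by rewrite (min_idPr tb) (max_idPr at_).
Qed.

Lemma continuous_clamp a b : continuous (clamp a b).
Proof.
move=> t; apply: continuous_max; first exact: cst_continuous.
by apply: continuous_min; [exact: cst_continuous|exact: cvg_id].
Qed.

Lemma rotation_eq_sub I J w Q : {subset J <= I} ->
  rotation_eq I w Q -> rotation_eq J w Q.
Proof.
move=> JI [Q0 dQ]; split=> // t tJ.
have nJI : \forall s \near t, s \in J -> s \in I
  by near=> s; exact: JI.
exact: is_derive_within_sub nJI (JI t tJ) (fun _ _ => erefl) (dQ t (JI t tJ)).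
Unshelve. all: by end_near. Qed.

(** Each column of a solution solves the vector equation. *)
Lemma rotation_eq_unique I w Q1 Q2 : 0 \in I ->
  rotation_eq I w Q1 -> rotation_eq I w Q2 -> forall t, t \in I -> Q1 t = Q2 t.
Proof.
move=> I0 [Q10 dQ1] [Q20 dQ2] t tI; apply/matrixP => i j.
have colE Q : Q t i j = (Q t *m delta_mx j 0 : 'cV_3) i 0.
  by rewrite -colE mxE.
rewrite !colE; congr (fun_of_matrix _ i 0).
apply: (@skew_equation_unique _ _ I (fun s => spin (w s))
  (fun s => Q1 s *m delta_mx j 0) (fun s => Q2 s *m delta_mx j 0)) => //.
- by move=> s _; exact: spin_skew.
- by move=> s sI; rewrite mulmxA; apply/is_derive_within_mulmx/dQ1.
- by move=> s sI; rewrite mulmxA; apply/is_derive_within_mulmx/dQ2.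
- by rewrite Q10 Q20.
Qed.

Definition continuous_within I w := forall t, t \in I -> forall i,
  w s i 0 @[s --> within [set` I] (nbhs t)] --> w t i 0.

Lemma differentiable_on_continuous I w :
  differentiable_on I w -> continuous_within I w.
Proof.
move=> dw t tI i; have [l /is_derive_within_mxP wl] := dw t tI.
exact: is_derive_within_continuous (wl i 0).
Qed.

Lemma spin_clamp_continuous I w a b : a <= b -> a \in I -> b \in I ->
  continuous_within I w -> entries_continuous (fun t => spin (w (clamp a b t))).
Proof.
move=> ab aI bI cw i j t.
have cI s : clamp a b s \in I.
  have := clamp_itv s ab; rewrite in_itv/=.
  exact: (@interval_is_interval _ I a b).
have cwi k : {for t, continuous (fun s => w (clamp a b s) k 0)}.
  apply: (@cvg_comp _ _ _ (clamp a b) (fun s => w s k 0) (nbhs t) _ _ _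
    (cw _ (cI t) k)) => W IW.
  have {}IW : \forall s \near t, clamp a b s \in I -> W (clamp a b s).
    exact: (@continuous_clamp a b t _ IW).
  suff : \forall s \near t, W (clamp a b s) by [].
  by near=> s; have := cI s; near: s; exact: IW.
rewrite (_ : (fun s => _) = fun s =>
    w (clamp a b s) (i + 1) 0 * (delta_mx j 0 : 'cV[R]_3) (i + 2) 0 -
    w (clamp a b s) (i + 2) 0 * (delta_mx j 0 : 'cV[R]_3) (i + 1) 0); last first.
  by apply/funext => s; rewrite 2!mxE.
by apply: cvgB; (apply: cvgM; [exact: cwi|exact: cvg_cst]).
Unshelve. all: by end_near. Qed.

(** Composition with [clamp a b] turns [spin \o w] into a matrix function that is
    continuous on the whole line and bounded by its maximum on the segment. *)
Lemma rotation_eq_segment I w a b : continuous_within I w ->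
  a \in I -> b \in I -> a <= 0 <= b -> exists Q, rotation_eq `[a, b] w Q.
Proof.
move=> cw aI bI /andP[a0 b0]; have ab := le_trans a0 b0.
pose A t := spin (w (clamp a b t)).
have cA : entries_continuous A by exact: spin_clamp_continuous cw.
have [c _ cmax] : exists2 c, c \in `[a, b] & forall t, t \in `[a, b] ->
    \sum_i \sum_j `|A t i j| <= \sum_i \sum_j `|A c i j|.
  apply: (@EVT_max _ (fun t => \sum_i \sum_j `|A t i j|)) => //.
  apply: continuous_subspaceT => t.
  apply: cvg_big => [|i _]; first exact: add_continuous.
  apply: cvg_big => [|j _]; first exact: add_continuous.
  by apply: cvg_norm; exact: cA.
pose M := \sum_i \sum_j `|A c i j|.
have M0 : 0 <= M by apply: sumr_ge0 => i _; apply: sumr_ge0.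
have A_le t i j : `|A t i j| <= M.
  apply: le_trans (cmax (clamp a b t) (clamp_itv t ab)).
  rewrite [A (clamp a b t)]/A clamp_id ?clamp_itv//.
  rewrite (bigD1 i)//= (bigD1 j)//= -addrA lerDl.
  by rewrite addr_ge0// ?sumr_ge0// => k _; apply: sumr_ge0.
have [Q [Q0 dQ]] := linear_equation_solution 1%:M cA A_le M0.
exists Q; split=> // t tab; apply/is_derive_within_mxP => i j.
apply: is_derive_is_derive_within.
by have := dQ t i j; rewrite /A clamp_id.
Qed.

Lemma rotation_matrixP I w : (exists Q, rotation_eq I w Q) ->
  rotation_eq I w (rotation_matrix I w).
Proof.
by move=> [Q QI]; apply: (@xgetPex _ _ [set Q | rotation_eq I w Q]); exists Q.
Qed.

(** A segment in [I] that contains 0 and is a neighbourhood of [t] relative to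
    [I]: on each side of [t] it extends to a further point of [I], or stops at [t]
    if there is none. *)
Lemma itv_hull0 I t : 0 \in I -> t \in I -> exists a b, [/\ a \in I, b \in I,
  a <= 0 <= b, t \in `[a, b] & \forall s \near t, s \in I -> s \in `[a, b]].
Proof.
move=> I0 tI.
have [a [aI a0 at_ na]] : exists a, [/\ a \in I, a <= 0, a <= t &
    \forall s \near t, s \in I -> a <= s].
  have [[a aI at_]|/forall2NP na] := pselect (exists2 a, a \in I & a < t).
    exists (Num.min a 0); split; rewrite ?ge_min ?lexx ?orbT ?(ltW at_)//.
      by rewrite /Num.min; case: ifP.
    by near=> s => _; rewrite ge_min ltW//; near: s; exact: lt_nbhsr.
  have It s : s \in I -> t <= s.
    by move=> sI; have [//|/negP] := na s; rewrite -leNgt.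
  exists t; split=> //; first exact: It.
  by near=> s; exact: It.
have [b [bI b0 tb nb]] : exists b, [/\ b \in I, 0 <= b, t <= b &
    \forall s \near t, s \in I -> s <= b].
  have [[b bI tb]|/forall2NP nb] := pselect (exists2 b, b \in I & t < b).
    exists (Num.max b 0); split; rewrite ?le_max ?lexx ?orbT ?(ltW tb)//.
      by rewrite /Num.max; case: ifP.
    by near=> s => _; rewrite le_max ltW//; near: s; exact: lt_nbhsl.
  have It s : s \in I -> s <= t.
    by move=> sI; have [//|/negP] := nb s; rewrite -leNgt.
  exists t; split=> //; first exact: It.
  by near=> s; exact: It.
exists a, b; split=> //; first exact/andP.
  by rewrite in_itv/= at_.
by apply: filterS2 na nb => s sa sb sI; rewrite in_itv/= sa// sb.
Unshelve. all: by end_near. Qed.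

(** The value at [t] is that of a solution on the segment between 0 and [t].  Near
    [t], all these segments lie in the one given by [itv_hull0], whose solution
    has the same values by uniqueness. *)
Lemma rotation_eq_solution I w : 0 \in I -> continuous_within I w ->
  exists Q, rotation_eq I w Q.
Proof.
move=> I0 cw.
pose hull (t : R) : interval R := `[Num.min 0 t, Num.max 0 t].
have hull_refl t : t \in hull t by rewrite in_itv/= ge_min le_max lexx !orbT.
have hull0 t : 0 \in hull t by rewrite in_itv/= ge_min le_max lexx.
have hullP t : t \in I -> rotation_eq (hull t) w (rotation_matrix (hull t) w).
  move=> tI; apply/rotation_matrixP/(rotation_eq_segment cw).
  - by rewrite /Num.min; case: ifP.
  - by rewrite /Num.max; case: ifP.
  - by rewrite ge_min le_max lexx.
exists (fun t => rotation_matrix (hull t) w t); split.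
  by have [] := hullP 0 I0.
move=> t tI; have [a [b [aI bI ab0 tab nab]]] := itv_hull0 I0 tI.
have [Q QP] := rotation_eq_segment cw aI bI ab0.
have abI s : s \in `[a, b] -> s \in I.
  by rewrite in_itv/=; exact: (@interval_is_interval _ I a b).
have QE : {in `[a, b], (fun t => rotation_matrix (hull t) w t) =1 Q}.
  move=> s sab.
  apply: (rotation_eq_unique (hull0 s) (hullP s (abI s sab))) => //.
  apply: rotation_eq_sub QP => r; move: sab ab0; rewrite !in_itv/=.
  rewrite ge_min le_max => /andP[sa sb] /andP[a0 b0].
  by move=> /andP[/orP[]r1 /orP[]r2]; apply/andP; split; lra.
have [_ dQ] := QP.
rewrite (QE t tab); exact: is_derive_within_sub nab tab QE (dQ t tab).
Qed.

End rotation.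

(** * Motion in a magnetic field *)

Theorem mainTheorem19 (R : realType) (m q : R) (I : interval R)
    (B v dv : R -> 'cV[R]_3) (v0 : 'cV[R]_3)
    (hm : 0 < m) (hI : 0 \in I)
    (hB : differentiable_on I B)
    (hdv : forall t, t \in I -> is_derive_within I v t (dv t))
    (newton : forall t, t \in I -> m *: dv t = q *: cross (v t) (B t))
    (hv0 : v 0 = v0) :
  v @` [set` I] `<=` sphere 0 (enorm v0) /\
  (forall t, t \in I ->
     v t = rotation_tensor I (fun s => - ((q / m) *: B s)) (fun=> v0) t).
Proof.
pose w s := - ((q / m) *: B s).
have dvE t : t \in I -> dv t = spin (w t) *m v t.
  move=> tI; have m0 : m != 0 by rewrite gt_eqF.
  rewrite spinE -[dv t](scalerK m0) newton// scalerA mulrC.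
  by apply/colP => i; rewrite !mxE; ring.
have dv_spin t : t \in I -> is_derive_within I v t (spin (w t) *m v t).
  by move=> tI; rewrite -dvE//; exact: hdv.
have skew t : t \in I -> (spin (w t))^T = - spin (w t) by rewrite spin_skew.
split.
  move=> _ [t tI <-]; rewrite /sphere/= /enorm subr0 -hv0; congr Num.sqrt.
  exact: (skew_sqnorm_constant skew dv_spin).
have cw : continuous_within I w.
  move=> t tI i.
  rewrite (_ : (fun s => _) = fun s => - (q / m * B s i 0)); last first.
    by apply/funext => s; rewrite !mxE.
  rewrite !mxE; apply: cvgN; apply: cvgM; first exact: cvg_cst.
  exact: differentiable_on_continuous.
have [Q0 dQ] := rotation_matrixP (rotation_eq_solution hI cw).
apply: (skew_equation_unique hI skew dv_spin) => [t tI|].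
  by rewrite mulmxA; apply/is_derive_within_mulmx/dQ.
by rewrite /rotation_tensor Q0 mul1mx.
Qed.
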